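(* Let $w\in F_2=F(x_1,x_2)$ be an Ivanov word and let $G_w$ be the double of $F_2$ along $w$. Then $G_w$ is not freely subgroup separable.
   Context: Freely subgroup separable: a group $L$ is freely subgroup separable if for every finitely generated subgroup $H\leq L$ and every element $g\in L\setminus H$ there exists a homomorphism $\varphi$ from $L$ to a free group such that $\varphi(g)\notin\varphi(H)$. Double: for $1\neq w\in F_2=F(x_1,x_2)$, the double of $F_2$ along $w$ is $G_w=A\ast_C B$ with $A=F(a_1,a_2)$, $B=F(b_1,b_2)$ free of rank 2, $C=\langle c\rangle\cong\mathbb{Z}$, and embeddings $c\mapsto w(a_1,a_2)$, $c\mapsto w(b_1,b_2)$. Thus $G_w=\langle a_1,a_2,b_1,b_2\mid w(a_1,a_2)=w(b_1,b_2)\rangle$. C-test word: a non-trivial word $w\in F_n$ is a C-test word in $n$ letters if for any two $n$-tuples $(A_1,\dots,A_n)$, $(B_1,\dots,B_n)$ of elements of a non-abelian free group $F$, the equality $w(A_1,\dots,A_n)=w(B_1,\dots,B_n)\neq1$ implies that there is $S\in F$ with $SA_iS^{-1}=B_i$ for all $i$. Ivanov word (in $F_2$): a C-test word $w\in F_2$ such that (i) $w$ is not a proper power; (ii) for elements $A_1,A_2$ of a free group, $w(A_1,A_2)=1$ if and only if $\langle A_1,A_2\rangle$ is cyclic; (iii) if $\varphi,\Psi$ are endomorphisms of $F_2$, $\Psi$ has non-cyclic image and $\varphi(w)=\Psi(w)$, then $\varphi=c_S\circ\Psi$ for some $S\in\langle\Psi(w)\rangle$, where $c_S$ denotes conjugation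 by $S$. It is known (Ivanov) that every C-test word in $F_n$ lies in the commutator subgroup of $F_n$. *)

(* Defs.v *)
From HB Require Import structures.
From mathcomp Require Import all_boot.
From mathcomp Require Import boolp classical_sets.

Set Implicit Arguments.
Unset Strict Implicit.
Unset Printing Implicit Defensive.

Local Open Scope classical_set_scope.
Local Open Scope group_scope.
Local Open Scope quotient_scope.

Notation group_hom G H := (UMagmaMorphism.type G H).

(* The group presented by generators X and relations s = t for R s t.
   A word is a list of letters; (x, true) stands for x, (x, false) for x^-1. *)
Section Presentation.
Variable X : choiceType.

Definition word := seq (X * bool).

Implicit Types s t u v : word.

Variable R : word -> word -> Prop.

Inductive word_cong : word -> word -> Prop :=
| word_cong_refl s : word_cong s s
| word_cong_sym s t : word_cong s t -> word_cong t s
| word_cong_trans s t u : word_cong s t -> word_cong t u -> word_cong s u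
| word_cong_cat s t u v :
    word_cong s t -> word_cong u v -> word_cong (s ++ u) (t ++ v)
| word_cong_cancel x b : word_cong [:: (x, b); (x, ~~ b)] [::]
| word_cong_rel s t : R s t -> word_cong s t.

Definition word_congb s t : bool := `[< word_cong s t >].

Lemma word_congb_refl : reflexive word_congb.
Proof. by move=> s; apply/asboolP; exact: word_cong_refl. Qed.

Lemma word_congb_sym : symmetric word_congb.
Proof. by move=> s t; apply/asboolP/asboolP; exact: word_cong_sym. Qed.

Lemma word_congb_trans : transitive word_congb.
Proof.
by move=> t s u /asboolP st /asboolP tu; apply/asboolP/(word_cong_trans st).
Qed.

Canonical word_equiv :=
  EquivRel word_congb word_congb_refl word_congb_sym word_congb_trans.

Definition presented : Type := {eq_quot word_equiv}.
HB.instance Definition _ := Choice.on presented.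
HB.instance Definition _ := Quotient.on presented.

Lemma presentedP s t : word_cong s t <-> \pi_presented s = \pi_presented t.
Proof.
split=> [st|/eqmodP/asboolP //]; by apply/eqmodP/asboolP.
Qed.

Lemma repr_cong s : word_cong (repr (\pi_presented s)) s.
Proof. by apply/presentedP; rewrite reprK. Qed.

Definition word_inv s : word := rev [seq (p.1, ~~ p.2) | p <- s].

Lemma word_inv_cat s t : word_inv (s ++ t) = word_inv t ++ word_inv s.
Proof. by rewrite /word_inv map_cat rev_cat. Qed.

Lemma word_invK : involutive word_inv.
Proof.
move=> s; rewrite /word_inv map_rev revK -map_comp -[RHS]map_id.
by apply: eq_map => -[x b] /=; rewrite negbK.
Qed.

Lemma word_cong_mulV s : word_cong (s ++ word_inv s) [::].
Proof.
elim/last_ind: s => [|s [x b] IH]; first exact: word_cong_refl.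
rewrite -cats1 word_inv_cat -catA.
apply: word_cong_trans IH; apply: word_cong_cat; first exact: word_cong_refl.
rewrite catA -[word_inv s in X in word_cong _ X]cat0s.
by apply: word_cong_cat; [exact: word_cong_cancel | exact: word_cong_refl].
Qed.

Lemma word_cong_mulVl s : word_cong (word_inv s ++ s) [::].
Proof. by rewrite -[s in X in _ ++ X]word_invK; exact: word_cong_mulV. Qed.

Lemma word_cong_inv s t : word_cong s t -> word_cong (word_inv s) (word_inv t).
Proof.
move=> st; pose r := word_cong_refl.
apply: (@word_cong_trans _ (word_inv s ++ (t ++ word_inv t))).
  rewrite -[X in word_cong X _]cats0; apply: word_cong_cat (r _) _.
  exact/word_cong_sym/word_cong_mulV.
rewrite catA -[X in word_cong _ X]cat0s; apply: word_cong_cat (r _).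
apply: word_cong_trans (word_cong_mulVl s).
by apply: word_cong_cat (r _) _; exact: word_cong_sym.
Qed.

Definition presented_one : presented := \pi_presented [::].
Definition presented_mul (x y : presented) : presented :=
  \pi_presented (repr x ++ repr y).
Definition presented_inv (x : presented) : presented :=
  \pi_presented (word_inv (repr x)).

Lemma presented_piM s t :
  \pi_presented (s ++ t) = presented_mul (\pi s) (\pi t).
Proof. by apply/presentedP/word_cong_cat; apply/word_cong_sym/repr_cong. Qed.

Lemma presented_piV s :
  \pi_presented (word_inv s) = presented_inv (\pi s).
Proof. by apply/presentedP/word_cong_inv/word_cong_sym/repr_cong. Qed.

Lemma presented_mulA : associative presented_mul.
Proof.
elim/quotW=> s; elim/quotW=> t; elim/quotW=> u.
by rewrite -!presented_piM catA.
Qed.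

Lemma presented_mul1g : left_id presented_one presented_mul.
Proof. by elim/quotW=> s; rewrite -presented_piM. Qed.

Lemma presented_mulg1 : right_id presented_one presented_mul.
Proof. by elim/quotW=> s; rewrite -presented_piM cats0. Qed.

Lemma presented_mulV : left_inverse presented_one presented_inv presented_mul.
Proof.
elim/quotW=> s; rewrite -presented_piV -presented_piM.
by apply/presentedP/word_cong_mulVl.
Qed.

Lemma presented_Vmul : right_inverse presented_one presented_inv presented_mul.
Proof.
elim/quotW=> s; rewrite -presented_piV -presented_piM.
by apply/presentedP/word_cong_mulV.
Qed.

HB.instance Definition _ := isGroup.Build presented
  presented_mulA presented_mul1g presented_mulg1 presented_mulV presented_Vmul.

Definition presented_gen (x : X) : presented := \pi_presented [:: (x, true)].

Lemma presented_hom_ext (H : groupType) (f g : group_hom presented H) :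
  (forall x, f (presented_gen x) = g (presented_gen x)) -> f =1 g.
Proof.
move=> fg; elim/quotW; elim=> [|[x b] s IH]; first by rewrite !gmulf1.
rewrite -cat1s presented_piM !gmulfM IH; congr (_ * _).
case: b; first exact: fg.
by rewrite -[[:: _]]/(word_inv [:: (x, true)]) presented_piV !gmulfV fg.
Qed.

Section Lift.
Variables (H : groupType) (f : X -> H).

Definition word_eval (s : word) : H :=
  \prod_(p <- s) (if p.2 then f p.1 else (f p.1)^-1).

Lemma word_eval_cat s t : word_eval (s ++ t) = word_eval s * word_eval t.
Proof. exact: big_cat. Qed.

Hypothesis fR : forall s t, R s t -> word_eval s = word_eval t.

Lemma word_eval_cong s t : word_cong s t -> word_eval s = word_eval t.
Proof.
elim=> // [{}s {}t u _ -> //|{}s {}t u v _ IH1 _ IH2|x b].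
  by rewrite !word_eval_cat IH1 IH2.
rewrite /word_eval !big_cons !big_nil mulg1.
by case: b; rewrite /= ?mulgV ?mulVg.
Qed.

Definition presented_lift (x : presented) : H := word_eval (repr x).

Lemma presented_lift_pi s : presented_lift (\pi_presented s) = word_eval s.
Proof. exact/word_eval_cong/repr_cong. Qed.

Lemma presented_lift_monoid_morphism : monoid_morphism presented_lift.
Proof.
split.
  by rewrite -[1]/(\pi_presented [::]) presented_lift_pi /word_eval big_nil.
elim/quotW=> s; elim/quotW=> t.
by rewrite -[_ * _]presented_piM !presented_lift_pi word_eval_cat.
Qed.

Lemma presented_lift_gen x : presented_lift (presented_gen x) = f x.
Proof. by rewrite presented_lift_pi /word_eval big_seq1. Qed.

End Lift.

End Presentation.

Section FreeGroup.
Variable X : choiceType.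

Definition free_group : Type := @presented X (fun _ _ => False).
HB.instance Definition _ := Group.on free_group.

Definition free_gen (x : X) : free_group := presented_gen _ x.

Lemma free_hom_ext (H : groupType) (f g : group_hom free_group H) :
  (forall x, f (free_gen x) = g (free_gen x)) -> f =1 g.
Proof. exact: presented_hom_ext. Qed.

Variables (H : groupType) (f : X -> H).

Definition free_lift (x : free_group) : H := presented_lift f x.

HB.instance Definition _ := isUMagmaMorphism.Build free_group H free_lift
  (@presented_lift_monoid_morphism X _ H f (fun s t => False_ind _)).

Lemma free_lift_gen x : free_lift (free_gen x) = f x.
Proof. exact: presented_lift_gen. Qed.

End FreeGroup.

(* A *_C B along f : C -> A and g : C -> B, as the pushout: generated by the
   elements of A and of B, subject to the multiplication tables of A and B and
   to f c = g c.  It is the free product with amalgamation when f and g are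
   injective; injectivity is not needed for the construction. *)
Section Amalgam.
Variables (C A B : groupType) (f : group_hom C A) (g : group_hom C B).

Inductive amalgam_rel : word (A + B)%type -> word (A + B)%type -> Prop :=
| amalgam_relL a a' :
    amalgam_rel [:: (inl a, true); (inl a', true)] [:: (inl (a * a'), true)]
| amalgam_relR b b' :
    amalgam_rel [:: (inr b, true); (inr b', true)] [:: (inr (b * b'), true)]
| amalgam_relC c :
    amalgam_rel [:: (inl (f c), true)] [:: (inr (g c), true)].

Definition amalgam : Type := presented amalgam_rel.
HB.instance Definition _ := Group.on amalgam.

Definition amalgam_inl (a : A) : amalgam := presented_gen amalgam_rel (inl a).
Definition amalgam_inr (b : B) : amalgam := presented_gen amalgam_rel (inr b).


Lemma amalgam_inl_monoid_morphism : monoid_morphism amalgam_inl.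
Proof.
have inlM : {morph amalgam_inl : x y / x * y}.
  move=> x y; rewrite -[RHS]presented_piM; apply/presentedP/word_cong_sym.
  exact/word_cong_rel/amalgam_relL.
by split=> //; apply: (@mulgI _ (amalgam_inl 1)); rewrite -inlM !mulg1.
Qed.

Lemma amalgam_inr_monoid_morphism : monoid_morphism amalgam_inr.
Proof.
have inrM : {morph amalgam_inr : x y / x * y}.
  move=> x y; rewrite -[RHS]presented_piM; apply/presentedP/word_cong_sym.
  exact/word_cong_rel/amalgam_relR.
by split=> //; apply: (@mulgI _ (amalgam_inr 1)); rewrite -inrM !mulg1.
Qed.

HB.instance Definition _ :=
  isUMagmaMorphism.Build A amalgam amalgam_inl amalgam_inl_monoid_morphism.
HB.instance Definition _ :=
  isUMagmaMorphism.Build B amalgam amalgam_inr amalgam_inr_monoid_morphism.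

Lemma amalgam_glue c : amalgam_inl (f c) = amalgam_inr (g c).
Proof. exact/presentedP/word_cong_rel/amalgam_relC. Qed.

Lemma amalgam_hom_ext (H : groupType) (h k : group_hom amalgam H) :
  (forall a, h (amalgam_inl a) = k (amalgam_inl a)) ->
  (forall b, h (amalgam_inr b) = k (amalgam_inr b)) -> h =1 k.
Proof. by move=> hk1 hk2; apply: presented_hom_ext => -[]. Qed.

Lemma amalgam_lift (H : groupType) (h : group_hom A H) (k : group_hom B H) :
  (forall c, h (f c) = k (g c)) ->
  exists l : group_hom amalgam H,
    (forall a, l (amalgam_inl a) = h a) /\ (forall b, l (amalgam_inr b) = k b).
Proof.
move=> hk; pose e (x : A + B) := match x with inl a => h a | inr b => k b end.
have eR s t : amalgam_rel s t -> word_eval e s = word_eval e t.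
  by case=> [a a'|b b'|c];
    rewrite /word_eval !big_cons !big_nil /= !mulg1 ?gmulfM.
pose M := isUMagmaMorphism.Build amalgam H (presented_lift e)
  (presented_lift_monoid_morphism eR).
pose l : group_hom amalgam H := HB.pack (presented_lift e : amalgam -> H) M.
by exists l; split=> x; exact: (presented_lift_gen eR).
Qed.

End Amalgam.

Section Subgroups.
Variable G : groupType.

Definition is_subgroup (H : set G) : Prop :=
  [/\ H 1, forall x y, H x -> H y -> H (x * y) & forall x, H x -> H x^-1].

Definition generated (S : set G) : set G := smallest is_subgroup S.

Definition finitely_generated (H : set G) : Prop :=
  exists s : seq G, H = generated [set` s].

Definition cyclic (H : set G) : Prop := exists z, H = generated [set z].

End Subgroups.

Definition nonabelian (G : groupType) : Prop := exists x y : G, x * y <> y * x.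

Definition proper_power (G : groupType) (x : G) : Prop :=
  exists (y : G) (k : nat), (1 < k)%N /\ x = y ^+ k.

(* Free groups are taken in the form free_group X throughout, X an arbitrary
   choiceType; classically every free group is isomorphic to one of these. *)
Definition freely_subgroup_separable (L : groupType) : Prop :=
  forall H : set L, is_subgroup H -> finitely_generated H ->
  forall g : L, ~ H g ->
  exists (X : choiceType) (phi : group_hom L (free_group X)),
    ~ (phi @` H) (phi g).

Notation F_ n := (free_group 'I_n).

(* w(A_1, ..., A_n) is free_lift A w. *)
Definition C_test_word (n : nat) (w : F_ n) : Prop :=
  w <> 1 /\
  forall X : choiceType, nonabelian (free_group X) ->
  forall A B : 'I_n -> free_group X,
    free_lift A w = free_lift B w -> free_lift B w <> 1 ->
    exists S : free_group X, forall i, S * A i * S^-1 = B i.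

Definition Ivanov_word (w : F_ 2) : Prop :=
  [/\ C_test_word w,
      ~ proper_power w,
      forall (X : choiceType) (A : 'I_2 -> free_group X),
        free_lift A w = 1 <-> cyclic (generated (range A))
    & forall phi Psi : group_hom (F_ 2) (F_ 2),
        ~ cyclic (range Psi) -> phi w = Psi w ->
        exists2 S, generated [set Psi w] S &
                   forall x, phi x = S * Psi x * S^-1].

(* The infinite cyclic group C = <c> is the free group on one generator; both
   maps to F_2 send c to w. *)
Definition double_group (w : F_ 2) : Type :=
  amalgam (free_lift (fun _ : unit => w)) (free_lift (fun _ : unit => w)).
HB.instance Definition _ (w : F_ 2) := Group.on (double_group w).

(* Main.v *)
(* The subgroup H = A and the element g = b_1 w(b) b_1^-1 of B violate free
   subgroup separability.
   For phi : G_w -> F, embed the finitely generated group phi(G_w) into F_2, and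
   let Psi, Phi be the resulting endomorphisms of F_2 given by phi on A and on
   B.  If Psi has cyclic image, then phi(w(b)) = phi(w(a)) = 1, so phi(g) = 1.
   Otherwise property (iii) gives Phi = c_S o Psi with S in <Psi(w)>, so Phi and
   Psi have the same image and phi(g) lies in phi(A).
   For g not in A, let A act on the set F_2 by left multiplication and B by the
   conjugate of this action by the bijection t that multiplies by w on <w> and
   is the identity elsewhere; t commutes with w, so G_w acts.  Comparing the
   actions of g and of a in A at x1 and at 1 gives a contradiction as soon as
   x1 and x1 w x1^-1 are not in <w>.
   For the latter, w is killed by x2 |-> 1, so it is a word in the elements
   x1^n x2 x1^-n, which are a free basis of a subgroup; conjugation by x1 shifts
   this basis and cannot map w <> 1 into <w>. *)
Require Import Defs.
From HB Require Import structures.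
From mathcomp Require Import all_boot.
From mathcomp Require Import ssralg ssrnum ssrint zify.
From mathcomp Require Import boolp classical_sets.

Set Implicit Arguments.
Unset Strict Implicit.
Unset Printing Implicit Defensive.

Local Open Scope classical_set_scope.
Local Open Scope group_scope.

(** * Generated subgroups, images, preimages and equalizers *)

Section Subgroup.
Variables G H : groupType.

Lemma is_subgroup_generated (S : set G) : is_subgroup (generated S).
Proof.
split=> [K [[]//]|x y Sx Sy K KP|x Sx K KP].
  by case: (KP) => -[_ KM _] _; apply: KM; [exact: Sx | exact: Sy].
by case: (KP) => -[_ _ KV] _; apply: KV; exact: Sx.
Qed.

Lemma sub_generated (S : set G) : S `<=` generated S.
Proof. exact: sub_smallest. Qed.

Lemma generated_sub (S K : set G) :
  is_subgroup K -> S `<=` K -> generated S `<=` K.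
Proof. by move=> Kg SK; apply: smallest_sub. Qed.

Lemma is_subgroup_image (f : group_hom G H) (K : set G) :
  is_subgroup K -> is_subgroup (f @` K).
Proof.
case=> K1 KM KV; split; first by exists 1; rewrite ?gmulf1.
- move=> _ _ [x Kx <-] [y Ky <-]; exists (x * y); rewrite ?gmulfM //.
  exact: KM.
- by move=> _ [x Kx <-]; exists x^-1; rewrite ?gmulfV //; exact: KV.
Qed.

Lemma is_subgroup_preimage (f : group_hom G H) (K : set H) :
  is_subgroup K -> is_subgroup (f @^-1` K).
Proof.
case=> K1 KM KV; split; rewrite /preimage /=; first by rewrite gmulf1.
- by move=> x y; rewrite gmulfM; exact: KM.
- by move=> x; rewrite gmulfV; exact: KV.
Qed.

Lemma is_subgroup_kernel (f : group_hom G H) : is_subgroup [set x | f x = 1].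
Proof.
apply: (is_subgroup_preimage f (K := [set 1])).
by split=> // [x y -> ->|x ->]; rewrite ?mulg1 ?invg1.
Qed.

Lemma is_subgroup_equalizer (f g : group_hom G H) :
  is_subgroup [set x | f x = g x].
Proof.
split=> /=; first by rewrite !gmulf1.
- by move=> x y xE yE; rewrite !gmulfM xE yE.
- by move=> x xE; rewrite !gmulfV xE.
Qed.

Lemma is_subgroup_range (f : group_hom G H) : is_subgroup (range f).
Proof. by apply: is_subgroup_image; split. Qed.

End Subgroup.

(* Locked, since simplification would unfold the morphism to free_lift, on
   which the lemmas for morphisms no longer rewrite. *)
HB.lock Definition free_hom (X : choiceType) (H : groupType) (f : X -> H) :
  group_hom (free_group X) H := free_lift f.

Lemma free_liftE (X : choiceType) (H : groupType) (f : X -> H) :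
  free_lift f =1 free_hom f.
Proof. by rewrite unlock. Qed.

(** * Induction and homomorphisms on free groups *)

Section FreeGroupTheory.
Variable X : choiceType.

Lemma free_subgroup_full (S : set (free_group X)) :
  is_subgroup S -> (forall x, S (free_gen x)) -> forall u, S u.
Proof.
move=> [S1 SM SV] Sx; elim/quotW; elim=> [//|[x b] s IH].
rewrite -cat1s presented_piM; apply: SM => //.
case: b; first exact: Sx.
by rewrite -[[:: _]]/(word_inv [:: (x, true)]) presented_piV; apply/SV/Sx.
Qed.

Lemma free_group_ind (P : free_group X -> Prop) :
  P 1 -> (forall x u, P u -> P (free_gen x * u)) ->
  (forall x u, P u -> P ((free_gen x)^-1 * u)) -> forall u, P u.
Proof.
move=> P1 PM PV u.
(* [P] need not be a subgroup, but the [v] for which multiplication by [v] and by [v^-1] both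
   preserve [P] form one. *)
pose S := [set v : free_group X |
  (forall u, P u -> P (v * u)) /\ (forall u, P u -> P (v^-1 * u))].
suff: S u by case=> /(_ 1 P1); rewrite mulg1.
apply: free_subgroup_full => [|x]; last by split; [exact: PM | exact: PV].
split.
- by split=> v Pv; rewrite ?invg1 mul1g.
- move=> x y [xM xV] [yM yV]; split=> v Pv; rewrite ?invgM -mulgA.
    exact/xM/yM.
  exact/yV/xV.
- by move=> x [xM xV]; split=> v Pv; rewrite ?invgK; [exact: xV | exact: xM].
Qed.

Lemma range_free_hom (H : groupType) (f : group_hom (free_group X) H) :
  range f = generated (range (fun x => f (free_gen x))).
Proof.
apply/seteqP; split.
- move=> _ [u _ <-]; move: u; apply: free_subgroup_full.
    exact/(is_subgroup_preimage f)/is_subgroup_generated.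
  by move=> x; apply: sub_generated; exists x.
- apply: generated_sub; first exact: is_subgroup_range.
  by move=> _ [x _ <-]; exists (free_gen x).
Qed.

Lemma free_hom_gen (H : groupType) (f : X -> H) x :
  free_hom f (free_gen x) = f x.
Proof. by rewrite -free_liftE free_lift_gen. Qed.

Lemma free_lift_hom (H : groupType) (f : group_hom (free_group X) H) :
  free_lift (fun x => f (free_gen x)) =1 f.
Proof.
by move=> u; rewrite free_liftE; apply: free_hom_ext => x; rewrite free_hom_gen.
Qed.

End FreeGroupTheory.

(** * The group of bijections of a type, as a target for actions *)

Section SelfBijections.
Variable T : Type.

Record selfbij := SelfBij {
  bij_fun :> T -> T;
  bij_inv : T -> T;
  bij_funK : cancel bij_fun bij_inv;
  bij_invK : cancel bij_inv bij_fun }.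

HB.instance Definition _ := gen_eqMixin selfbij.
HB.instance Definition _ := gen_choiceMixin selfbij.

Lemma selfbij_ext (f g : selfbij) : f =1 g -> f = g.
Proof.
case: f g => [f f' fK f'K] [g g' gK g'K] /= fg.
have fE : f = g by apply/funext.
subst g; have f'E : f' = g'.
  by apply/funext => x; rewrite -{1}(g'K x) fK.
by subst g'; congr SelfBij; exact: Prop_irrelevance.
Qed.

Definition bij_one : selfbij := @SelfBij id id (frefl _) (frefl _).
Definition bij_mul (f g : selfbij) : selfbij :=
  SelfBij (can_comp (bij_funK f) (bij_funK g))
          (can_comp (bij_invK g) (bij_invK f)).
Definition bij_opp (f : selfbij) : selfbij :=
  SelfBij (bij_invK f) (bij_funK f).

Lemma bij_mulA : associative bij_mul.
Proof. by move=> f g h; exact: selfbij_ext. Qed.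
Lemma bij_mul1g : left_id bij_one bij_mul.
Proof. by move=> f; exact: selfbij_ext. Qed.
Lemma bij_mulg1 : right_id bij_one bij_mul.
Proof. by move=> f; exact: selfbij_ext. Qed.
Lemma bij_mulVg : left_inverse bij_one bij_opp bij_mul.
Proof. by move=> f; apply: selfbij_ext; exact: bij_funK. Qed.
Lemma bij_mulgV : right_inverse bij_one bij_opp bij_mul.
Proof. by move=> f; apply: selfbij_ext; exact: bij_invK. Qed.

HB.instance Definition _ := isGroup.Build selfbij
  bij_mulA bij_mul1g bij_mulg1 bij_mulVg bij_mulgV.

Lemma bijM (f g : selfbij) x : (f * g) x = f (g x). Proof. by []. Qed.

End SelfBijections.

Section LeftMul.
Variable G : groupType.

Definition left_mul (g : G) : selfbij G := SelfBij (mulKg g) (mulVKg g).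

Lemma left_mul_monoid_morphism : monoid_morphism left_mul.
Proof.
split; first by apply: selfbij_ext => x /=; rewrite mul1g.
by move=> x y; apply: selfbij_ext => z /=; rewrite mulgA.
Qed.

HB.instance Definition _ := isUMagmaMorphism.Build G (selfbij G) left_mul
  left_mul_monoid_morphism.

End LeftMul.

(** * Integer powers *)

Section IntPower.
Variable G : groupType.

Definition zpow (g : G) (n : int) : G :=
  match n with Posz n => g ^+ n | Negz n => g ^- n.+1 end.

Lemma zpowS g n : zpow g (n + 1)%R = g * zpow g n.
Proof.
case: n => [n|[|n]].
- by rewrite (_ : (Posz n + 1)%R = Posz n.+1) /= ?expgS //; lia.
- by rewrite /= expg1 mulgV.
- rewrite (_ : (Negz n.+1 + 1)%R = Negz n); last by lia.
  by rewrite /= [g ^+ n.+2]expgSr invgM mulVKg.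
Qed.

End IntPower.

Lemma int_step_ind (P : int -> Prop) :
  P 0%R -> (forall n, P n <-> P (n + 1)%R) -> forall n, P n.
Proof.
move=> P0 PS [] n.
  by elim: n => // n /PS; rewrite (_ : (Posz n + 1)%R = Posz n.+1) //; lia.
by elim: n => [|n IH]; apply/PS => //; rewrite (_ : (_ + 1)%R = Negz n) //; lia.
Qed.

Lemma I2_ind (P : 'I_2 -> Prop) : P ord0 -> P ord_max -> forall i, P i.
Proof.
move=> P0 P1 [[|[|//]] i2].
  by rewrite (_ : Ordinal _ = ord0) //; exact/val_inj.
by rewrite (_ : Ordinal _ = ord_max) //; exact/val_inj.
Qed.

(** * The conjugates of [x2] by powers of [x1] *)

Notation F_int := (free_group int).
Notation x1 := (free_gen (ord0 : 'I_2)).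
Notation x2 := (free_gen (ord_max : 'I_2)).

Definition pair_fun (T : Type) (a b : T) (i : 'I_2) : T :=
  if i == ord0 then a else b.

(** The image is the normal closure of [x2]; injectivity is [conj_emb_inj]. *)
Definition conj_emb : group_hom F_int (F_ 2) :=
  free_hom (fun n => zpow x1 n * x2 * (zpow x1 n)^-1).

Definition shift (d : int) : group_hom F_int F_int :=
  free_hom (fun n => free_gen (n + d)%R).

Lemma shiftK d e : (d + e)%R = 0%R -> cancel (shift d) (shift e).
Proof.
move=> de; apply: (@free_hom_ext _ _ (shift e \o shift d) idfun) => n.
by rewrite /= !free_hom_gen -GRing.addrA de GRing.addr0.
Qed.

Lemma conj_emb_shift u : conj_emb (shift 1 u) = x1 * conj_emb u * x1^-1.
Proof.
move: u; apply: free_subgroup_full => [|n].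
  split=> /=; first by rewrite !gmulf1 mulg1 mulgV.
  - by move=> u v uE vE; rewrite !gmulfM uE vE -!mulgA mulKg.
  - by move=> u uE; rewrite !gmulfV uE !invgM invgK !mulgA.
by rewrite /= !free_hom_gen zpowS invgM !mulgA.
Qed.

Definition shift_bij : selfbij F_int :=
  SelfBij (@shiftK 1 (-1)%R erefl) (@shiftK (-1)%R 1 erefl).

Lemma shift_bij_left_mul u :
  shift_bij * left_mul u * shift_bij^-1 = left_mul (shift 1 u).
Proof.
apply: selfbij_ext => v; rewrite !bijM /= gmulfM; congr (_ * _).
exact: (bij_invK shift_bij).
Qed.

(** The action of the semidirect product of [F_int] by the shift; it serves to recover [u] from
    [conj_emb u], by evaluation at 1. *)
Definition shift_rep : group_hom (F_ 2) (selfbij F_int) :=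
  free_hom (pair_fun shift_bij (left_mul (free_gen 0%R))).

(** On generators: conjugating left multiplication by the letter 0 with the [n]-th power of the
    shift gives left multiplication by the letter [n]. *)
Lemma shift_rep_conj_emb u : shift_rep (conj_emb u) = left_mul u.
Proof.
apply: (@free_hom_ext _ _ (shift_rep \o conj_emb) (@left_mul F_int)) => n.
rewrite /= free_hom_gen; move: n.
have x1E : shift_rep x1 = shift_bij by rewrite free_hom_gen.
apply: int_step_ind => [|n].
  by rewrite /= mul1g invg1 mulg1 free_hom_gen.
set y := zpow x1 n; rewrite zpowS -/y.
have -> : x1 * y * x2 * (x1 * y)^-1 = x1 * (y * x2 * y^-1) * x1^-1.
  by rewrite invgM !mulgA.
move: (y * x2 * y^-1) => z.
have -> : shift_rep (x1 * z * x1^-1) = shift_bij * shift_rep z * shift_bij^-1.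
  by rewrite -x1E !gmulfM gmulfV.
have -> : free_gen (n + 1)%R = shift 1 (free_gen n) by rewrite free_hom_gen.
by rewrite -shift_bij_left_mul; split=> [->//|/mulIg/mulgI].
Qed.

Lemma conj_emb_inj : injective conj_emb.
Proof.
move=> u v /(congr1 shift_rep); rewrite !shift_rep_conj_emb.
by move=> /(congr1 (fun f : selfbij F_int => f 1)); rewrite /= !mulg1.
Qed.

(** Such products are stable under left multiplication by generators: [x1] shifts [u] and raises
    [m], while [x2] multiplies [u] by the letter 0. *)
Lemma conj_emb_decomp g : exists u m, g = conj_emb u * zpow x1 m.
Proof.
move: g; apply: free_group_ind; first by exists 1, 0%R; rewrite gmulf1 mulg1.
- move=> i _ [u [m ->]]; elim/I2_ind: i.
    exists (shift 1 u), (m + 1)%R.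
    by rewrite conj_emb_shift zpowS -!mulgA mulKg.
  exists (free_gen 0%R * u), m.
  by rewrite gmulfM free_hom_gen /= mul1g invg1 mulg1 !mulgA.
- move=> i _ [u [m ->]]; elim/I2_ind: i.
    exists (shift (-1)%R u), (m - 1)%R.
    have uE : u = shift 1 (shift (-1)%R u) by rewrite (@shiftK (-1)%R 1).
    have mE : m = ((m - 1) + 1)%R by lia.
    by rewrite {1}uE conj_emb_shift {1}mE zpowS -!mulgA !mulKg.
  exists ((free_gen 0%R)^-1 * u), m.
  by rewrite gmulfM gmulfV free_hom_gen /= mul1g invg1 mulg1 !mulgA.
Qed.

(** Let [x1] act on the integers by adding 1; then its [m]-th power sends 0 to [m]. *)
Lemma zpow_x1_eq1 m : zpow x1 m = 1 -> m = 0%R.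
Proof.
pose s : selfbij int := SelfBij (GRing.addrK 1%R) (GRing.subrK 1%R).
pose f : group_hom (F_ 2) (selfbij int) := free_hom (pair_fun s s).
have fE : f (zpow x1 m) 0%R = m.
  move: m; apply: int_step_ind; first by rewrite /= gmulf1.
  move=> n; rewrite zpowS gmulfM free_hom_gen bijM.
  by split=> [->//|/GRing.addIr].
by move=> mE; rewrite -fE mE gmulf1.
Qed.

(** * Truncation of words, and why a shift leaves the cyclic subgroup *)

Definition trunc (n : int) : group_hom F_int F_int :=
  free_hom (fun i : int => if (i < n)%R then free_gen i else 1).

(** Only finitely many letters occur in [u], so they have an upper bound; [trunc_eq1] uses a lower
    bound in the same way. *)
Lemma trunc_id u : exists N, forall n : int, (N <= n)%R -> trunc n u = u.
Proof.
move: u; apply: free_subgroup_full => [|i]; last first.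
  exists (i + 1)%R => n iN; rewrite free_hom_gen; case: ifP => //; lia.
split=> /=; first by exists 0%R => n _; rewrite gmulf1.
- move=> u v [N uN] [M vM]; exists (Num.max N M) => n nNM.
  by rewrite gmulfM uN ?vM //; lia.
- by move=> u [N uN]; exists N => n nN; rewrite gmulfV uN.
Qed.

Lemma trunc_eq1 u : exists N, forall n : int, (n <= N)%R -> trunc n u = 1.
Proof.
move: u; apply: free_subgroup_full => [|i]; last first.
  exists i => n iN; rewrite free_hom_gen; case: ifP => //; lia.
split=> /=; first by exists 0%R => n _; rewrite gmulf1.
- move=> u v [N uN] [M vM]; exists (Num.min N M) => n nNM.
  by rewrite gmulfM uN ?vM ?mulg1 //; lia.
- by move=> u [N uN]; exists N => n nN; rewrite gmulfV uN ?invg1.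
Qed.

Lemma shift_trunc n u : shift 1 (trunc n u) = trunc (n + 1)%R (shift 1 u).
Proof.
apply: (@free_hom_ext _ _ (shift 1 \o trunc n)
         (trunc (n + 1)%R \o shift 1)) => i /=.
rewrite !free_hom_gen (_ : (i + 1 < n + 1)%R = (i < n)%R); last by lia.
by case: ifP => _; rewrite ?free_hom_gen ?gmulf1.
Qed.

(* If u is a word in the letters below n + 1, so is shift 1 u, hence u is a
   word in the letters below n; iterating downwards, no letter is left. *)
Lemma shift_generated_eq1 u : generated [set u] (shift 1 u) -> u = 1.
Proof.
move=> su; have [N uN] := trunc_id u; have [M uM] := trunc_eq1 u.
have step n : trunc (n + 1)%R u = u -> trunc n u = u.
  move=> un; apply: (can_inj (@shiftK 1 (-1)%R erefl)).
  rewrite shift_trunc.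
  apply: (generated_sub (is_subgroup_equalizer (trunc (n + 1)%R) idfun) _ su).
  by move=> _ ->.
have down (k : nat) : trunc (N - Posz k)%R u = u.
  elim: k => [|k IH]; first by apply: uN; lia.
  by apply: step; rewrite -[RHS]IH; congr (trunc _ u); lia.
by rewrite -(down `|N - M|%N) uM //; lia.
Qed.

(** * Finitely generated subgroups of free groups inside [F_ 2] *)

Lemma generated_letters (X : choiceType) (s : seq (free_group X)) :
  exists Y : seq X, [set` s] `<=` generated [set free_gen x | x in [set` Y]].
Proof.
have mono (Y Z : seq X) : {subset Y <= Z} ->
    generated [set free_gen x | x in [set` Y]] `<=`
    generated [set free_gen x | x in [set` Z]].
  move=> YZ; apply: generated_sub; first exact: is_subgroup_generated.
  by move=> _ [x /= xY <-]; apply: sub_generated; exists x => //=; exact: YZ.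
have one (u : free_group X) :
    exists Y : seq X, generated [set free_gen x | x in [set` Y]] u.
  move: u; apply: free_subgroup_full => [|x]; last first.
    by exists [:: x]; apply: sub_generated; exists x => //=; rewrite inE.
  split=> /= [|u v [Y Yu] [Z Zv]|u [Y Yu]].
  - exists [::].
    by case: (is_subgroup_generated [set free_gen x | x in [set` [::] : seq X]]).
  - have [_ M _] := is_subgroup_generated
      [set free_gen x | x in [set` Y ++ Z]].
    exists (Y ++ Z); apply: M; [apply: mono Yu | apply: mono Zv] => x xY;
    by rewrite mem_cat xY ?orbT.
  - have [_ _ V] := is_subgroup_generated [set free_gen x | x in [set` Y]].
    by exists Y; exact: V.
elim: s => [|u s [Y sY]]; first by exists [::].
have [Z Zu] := one u; exists (Z ++ Y) => v /=; rewrite inE => /orP[/eqP->|vs].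
  by apply: mono Zu => x xZ; rewrite mem_cat xZ.
by apply: (mono Y) (sY _ vs) => x xY; rewrite mem_cat xY orbT.
Qed.

(** Injectivity is claimed on the subgroup only, since [X] may be uncountable. Numbering the
    finitely many letters that occur in [s] leads into [F_int], and [conj_emb] leads on to
    [F_ 2]. *)
Lemma free_group_embed2 (X : choiceType) (s : seq (free_group X)) :
  exists f : group_hom (free_group X) (F_ 2),
    forall u v, generated [set` s] u -> generated [set` s] v ->
    f u = f v -> u = v.
Proof.
have [Y sY] := generated_letters s.
pose rho : group_hom (free_group X) F_int :=
  free_hom (fun x => free_gen (Posz (index x Y))).
(* A left inverse of [rho] on words in [Y]. Letters outside [Y] all get the index [size Y], which
   the default value sends to 1. *)
pose kappa : group_hom F_int (free_group X) :=
  free_hom (fun n : int => nth 1 (map (@free_gen X) Y) `|n|%N).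
have eqK : is_subgroup [set u | kappa (rho u) = u].
  exact: (@is_subgroup_equalizer _ _ (kappa \o rho) idfun).
have K : generated [set` s] `<=` [set u | kappa (rho u) = u].
  apply: generated_sub => // u /sY; apply: generated_sub => //.
  move=> _ [x /= xY <-]; rewrite !free_hom_gen /=.
  by rewrite (nth_map x) ?nth_index ?index_mem.
exists (conj_emb \o rho) => u v su sv /conj_emb_inj uv.
by rewrite -(K _ su) -(K _ sv) uv.
Qed.

(** * Ivanov words, and an action of the double on [F_ 2] *)

Section Ivanov.
Variable w : F_ 2.
Hypothesis hw : Ivanov_word w.

Let w_neq1 : w <> 1.
Proof. by case: hw => -[]. Qed.

Let w_cyclic (X : choiceType) (A : 'I_2 -> free_group X) :
  cyclic (generated (range A)) -> free_hom A w = 1.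
Proof. by case: hw => _ _ h _ /h; rewrite free_liftE. Qed.

Definition kill_x2 : group_hom (F_ 2) (F_ 2) := free_hom (pair_fun x1 1).

(** The pair [x1], 1 generates a cyclic subgroup, so property (ii) applies. *)
Let kill_x2_w : kill_x2 w = 1.
Proof.
apply: w_cyclic; exists x1; apply/seteqP.
split; apply: generated_sub; try exact: is_subgroup_generated.
  move=> _ [i _ <-]; elim/I2_ind: i; first exact: sub_generated.
  by case: (is_subgroup_generated [set x1]).
by move=> _ ->; apply: sub_generated; exists ord0.
Qed.

Let kill_x2_zpow m : kill_x2 (zpow x1 m) = zpow x1 m.
Proof.
have x1E : kill_x2 x1 = x1 by rewrite free_hom_gen.
by case: m => n /=; rewrite ?gmulfXVn ?gmulfXn x1E.
Qed.

(** In the decomposition of [w], [kill_x2] kills the factor [conj_emb u] and fixes the power of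
    [x1]; as it kills [w], that power is trivial. *)
Lemma Ivanov_word_conj_emb : exists u, w = conj_emb u.
Proof.
have [u [m wE]] := conj_emb_decomp w.
suff m0 : m = 0%R by exists u; rewrite wE m0 mulg1.
have kill_emb : kill_x2 (conj_emb u) = 1.
  move: u {wE}; apply: free_subgroup_full => [|n].
    exact: (is_subgroup_kernel (kill_x2 \o conj_emb)).
  by rewrite free_hom_gen !gmulfM gmulfV free_hom_gen /= mulg1 mulgV.
apply: zpow_x1_eq1; rewrite -kill_x2_zpow -[LHS]mul1g -kill_emb.
by rewrite -gmulfM -wE kill_x2_w kill_emb.
Qed.

(** Pulled back along the injective [conj_emb], conjugation by [x1] becomes the shift, and
    [shift_generated_eq1] applies. *)
Lemma conj_Ivanov_word : ~ generated [set w] (x1 * w * x1^-1).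
Proof.
have [u wE] := Ivanov_word_conj_emb.
rewrite wE -conj_emb_shift => su; apply: w_neq1; rewrite wE.
suff -> : u = 1 by rewrite gmulf1.
apply: shift_generated_eq1.
have imK : is_subgroup (conj_emb @` generated [set u]).
  exact/is_subgroup_image/is_subgroup_generated.
have [|v uv /conj_emb_inj <- //] := generated_sub imK _ su.
by move=> _ ->; exists u => //; exact: sub_generated.
Qed.

(** [kill_x2] is trivial on the subgroup generated by [w] but fixes [x1]. *)
Lemma x1_notin_Ivanov_word : ~ generated [set w] x1.
Proof.
move=> x1w.
have x1E : kill_x2 x1 = 1.
  by apply: (generated_sub (is_subgroup_kernel kill_x2) _ x1w) => _ ->.
have /zpow_x1_eq1 // : zpow x1 1 = 1.
by rewrite -[RHS]x1E free_hom_gen.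
Qed.

(* Multiplication by v on the subgroup <w> and the identity elsewhere; for
   v = w it commutes with left multiplication by w. *)
Definition coset_twist_fun (v x : F_ 2) : F_ 2 :=
  if `[< generated [set w] x >] then v * x else x.

Lemma coset_twistK (v : F_ 2) : generated [set w] v ->
  cancel (coset_twist_fun v) (coset_twist_fun v^-1).
Proof.
move=> wv x; rewrite /coset_twist_fun.
have [_ M _] := is_subgroup_generated [set w].
case: (asboolP (generated [set w] x)) => wx; last by rewrite asboolF.
by rewrite asboolT ?mulKg //; exact: M.
Qed.

Let ww : generated [set w] w. Proof. exact: sub_generated. Qed.
Let wV : generated [set w] w^-1.
Proof. by case: (is_subgroup_generated [set w]) => _ _; apply. Qed.

Lemma coset_twistVK : cancel (coset_twist_fun w^-1) (coset_twist_fun w).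
Proof. by rewrite -{2}[w]invgK; exact: coset_twistK. Qed.

Definition coset_twist : selfbij (F_ 2) :=
  SelfBij (coset_twistK ww) coset_twistVK.

Lemma coset_twist_id x : ~ generated [set w] x -> coset_twist x = x.
Proof. by move=> wx; rewrite /= /coset_twist_fun asboolF. Qed.

(** Left multiplication by [w] preserves the subgroup generated by [w] and its complement; on the
    former both maps multiply by [w]. *)
Lemma coset_twist_comm : coset_twist * left_mul w = left_mul w * coset_twist.
Proof.
apply: selfbij_ext => x; rewrite !bijM /= /coset_twist_fun.
have [_ M _] := is_subgroup_generated [set w].
case: (asboolP (generated [set w] x)) => wx.
  by rewrite asboolT //; exact: M.
rewrite asboolF // => wwx; apply: wx.
by rewrite -(mulKg w x); exact: M.
Qed.

Definition twisted_left_mul : group_hom (F_ 2) (selfbij (F_ 2)) :=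
  free_hom (fun i => coset_twist * left_mul (free_gen i) * coset_twist^-1).

Lemma twisted_left_mulE v :
  twisted_left_mul v = coset_twist * left_mul v * coset_twist^-1.
Proof.
move: v; apply: free_subgroup_full => [|i]; last by rewrite /= free_hom_gen.
split=> [|u v uE vE|u uE]; rewrite /mkset.
- by rewrite !gmulf1 mulg1 mulgV.
- by rewrite !gmulfM uE vE -!mulgA mulKg.
- by rewrite !gmulfV uE !invgM invgK !mulgA.
Qed.

Definition double_inl : group_hom (F_ 2) (double_group w) :=
  amalgam_inl (free_lift (fun _ : unit => w)) (free_lift (fun _ : unit => w)).

Definition double_inr : group_hom (F_ 2) (double_group w) :=
  amalgam_inr (free_lift (fun _ : unit => w)) (free_lift (fun _ : unit => w)).

Lemma double_glue : double_inl w = double_inr w.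
Proof.
have := amalgam_glue (free_lift (fun _ : unit => w))
  (free_lift (fun _ : unit => w)) (free_gen tt).
by rewrite /= free_lift_gen.
Qed.

Lemma double_inr_conj a : double_inr (x1 * w * x1^-1) <> double_inl a.
Proof.
set v := x1 * w * x1^-1; move=> va.
have [|l [lA lB]] := @amalgam_lift _ _ _ (free_lift (fun _ : unit => w))
    (free_lift (fun _ : unit => w)) _ (@left_mul (F_ 2)) twisted_left_mul.
  (* The two actions agree on the amalgamated subgroup because the twist commutes with [w]. *)
  apply: (@free_hom_ext _ _ (@left_mul (F_ 2) \o free_lift (fun _ : unit => w))
    (twisted_left_mul \o free_lift (fun _ : unit => w))) => i /=.
  by rewrite free_lift_gen twisted_left_mulE coset_twist_comm mulgK.
have vtwist : coset_twist * left_mul v = left_mul a * coset_twist.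
  by rewrite -(lA a) -[amalgam_inl _ _ a]va lB twisted_left_mulE mulgVK.
have vw : ~ generated [set w] v := conj_Ivanov_word.
have x1w := x1_notin_Ivanov_word.
(* At [x1] the twist does nothing: neither [x1] nor [v * x1 = x1 * w] lies in the subgroup generated
   by [w]. *)
have aE : a = v.
  have := congr1 (fun f : selfbij (F_ 2) => f x1) vtwist.
  rewrite !bijM (coset_twist_id x1w) coset_twist_id => [/mulIg //|].
  rewrite /= /v mulgVK => x1ww; apply: x1w.
  have [_ M _] := is_subgroup_generated [set w].
  by rewrite -(mulgK w x1); exact: M.
(* At 1 the twist gives [w] but it fixes [v], so [v = v * w], against [w <> 1]. *)
have := congr1 (fun f : selfbij (F_ 2) => f 1) vtwist.
rewrite !bijM aE coset_twist_id /= mulg1 // /coset_twist_fun asboolT.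
  by rewrite mulg1 -{1}[v]mulg1 => /mulgI /esym.
by case: (is_subgroup_generated [set w]).
Qed.

End Ivanov.

(** * Homomorphisms from the double to free groups *)

Theorem corollary2p10 (w : F_ 2) (hw : Ivanov_word w) :
  ~ freely_subgroup_separable (double_group w).
Proof.
pose iA := double_inl w; pose iB := double_inr w; pose v := x1 * w * x1^-1.
have iA_fg : finitely_generated (range iA).
  exists [:: iA x1; iA x2]; rewrite range_free_hom; congr generated.
  apply/seteqP; split.
    by move=> _ [i _ <-]; elim/I2_ind: i; rewrite /= !inE eqxx ?orbT.
  by move=> y /=; rewrite !inE => /orP[]/eqP->; [exists ord0 | exists ord_max].
move=> /(_ _ (is_subgroup_range iA) iA_fg (iB v)) [|X [phi]].
  by move=> [a _ /esym]; exact: double_inr_conj.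
apply.
(* These elements generate the image of [phi]. Moving it into [F_ 2] is what makes property (iii),
   on endomorphisms of [F_ 2], available. *)
pose s := [:: phi (iA x1); phi (iA x2); phi (iB x1); phi (iB x2)].
have [f f_inj] := free_group_embed2 s.
have sA u : generated [set` s] (phi (iA u)).
  move: u; apply: free_subgroup_full => [|i].
    exact/(is_subgroup_preimage (phi \o iA))/is_subgroup_generated.
  by apply: sub_generated => /=; elim/I2_ind: i; rewrite !inE eqxx ?orbT.
have sB u : generated [set` s] (phi (iB u)).
  move: u; apply: free_subgroup_full => [|i].
    exact/(is_subgroup_preimage (phi \o iB))/is_subgroup_generated.
  by apply: sub_generated => /=; elim/I2_ind: i; rewrite !inE eqxx ?orbT.
pose Psi : group_hom (F_ 2) (F_ 2) := f \o (phi \o iA).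
pose Phi : group_hom (F_ 2) (F_ 2) := f \o (phi \o iB).
suff [a _ aE] : range Psi (Phi v).
  by exists (iA a); [exists a | exact: f_inj].
have PhiE : Phi w = Psi w by rewrite /Phi /Psi /= double_glue.
have [_ _ Psi_cyclic Psi_conj] := hw.
have [cyc|ncyc] := EM (cyclic (range Psi)).
  have Psiw : Psi w = 1.
    by rewrite -(free_lift_hom Psi); apply/Psi_cyclic; rewrite -range_free_hom.
  by exists 1; rewrite // /v !gmulfM gmulfV PhiE Psiw gmulf1 mulg1 mulgV.
have [S PsiS SE] := Psi_conj Phi Psi ncyc PhiE.
have [|c _ cE] := generated_sub (is_subgroup_range Psi) _ PsiS.
  by move=> _ ->; exists w.
(* With [S = Psi c], conjugation by [S] can be carried out inside the argument of [Psi]. *)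
exists (c * v * c^-1) => //; rewrite SE -cE.
by move: v => u; rewrite !gmulfM gmulfV.
Qed.
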